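(* Suppose that $(x_n)_{n\in\mathbb{N}}$ is a stationary and ergodic sequence of random variables, that $P(x_1\in(-1,1))=1$, and that $E(\gamma_1)$ is well defined, possibly infinite. Let $\varepsilon_x=\operatorname{sign}(E(\gamma_1))$ and assume in addition that $\varepsilon_x\ne0$. Then with probability one, $$\lim_{n\to\infty}\frac1n B_{\varepsilon_x\alpha}\bigl(U_n(z)\bigr)=-\bigl|E(\gamma_1)\bigr|\quad\text{and}\quad\lim_{n\to\infty}\frac1n d_{\mathfrak p}\bigl(0,U_n(z)\bigr)=\bigl|E(\gamma_1)\bigr|$$ for all $z\in\mathcal{D}$.
   Context: $\mathcal{D}$ is the open unit disk in $\mathbb{C}$ centered at $0$, $\overline{\mathcal{D}}$ its closure, $\partial\mathcal{D}$ the unit circle. Fix $\alpha\in\partial\mathcal{D}$. For $x\in(-1,1)$ let $q_{x,\alpha}(z)=\frac{z+x\alpha}{1+x\bar\alpha z}$ for $z\in\overline{\mathcal{D}}$. For $\gamma\in\mathbb{R}$ let $g_\gamma:=q_{x,\alpha}$ where $x\in(-1,1)$ is determined by $\gamma=\log\frac{1+x}{1-x}$. Given the sequence $(x_n)$, put $\gamma_n=\log\frac{1+x_n}{1-x_n}$, $\omega_0=0$, $\omega_n=\sum_{i=1}^n\gamma_i$, and $U_n:=g_{\omega_n}$ for $n\in\mathbb{Z}_+=\mathbb{N}\cup\{0\}$. For $\xi\in\partial\mathcal{D}$ the Busemann function is $B_\xi(z)=-\log\Bigl(\frac{1-|z|^2}{|\xi-z|^2}\Bigr)$, $z\in\mathcal{D}$.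 The Poincar\'e distance on $\mathcal{D}$ is $d_{\mathfrak p}(z,w)=\log\Bigl(\frac{1+\rho_{z,w}}{1-\rho_{z,w}}\Bigr)$ with $\rho_{z,w}=\Bigl|\frac{z-w}{1-\bar z w}\Bigr|$. *)

(* Defs.v *)
From HB Require Import structures.
From mathcomp Require Import all_boot all_order all_algebra.
From mathcomp Require Import all_classical all_reals all_analysis.
From mathcomp Require Import complex.
From mathcomp Require Import ring lra.

Set Implicit Arguments.
Unset Strict Implicit.
Unset Printing Implicit Defensive.
Import Order.TTheory GRing.Theory Num.Theory.
Import numFieldNormedType.Exports.
Import ComplexField.Normc.

Local Open Scope classical_set_scope.
Local Open Scope ring_scope.

(* [normc] is the R-valued modulus on the complex numbers R[i]. *)

(** Sequences [s : nat -> R] are indexed from 0: [s n] is the (n+1)-st term. *)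

Definition seq_shift {R : Type} (s : nat -> R) : nat -> R := fun n => s n.+1.

Definition cylinder_sigma_algebra (R : realType) : set (set (nat -> R)) :=
  <<s \bigcup_n preimage_set_system setT (fun s : nat -> R => s n) measurable >>.

Section stationary_ergodic.
Context (R : realType) (d : measure_display) (T : measurableType d).
Variables (P : probability T R) (x : nat -> {RV P >-> R}).

Definition sample_path (w : T) : nat -> R := fun n => x n w.

(** The law of the sequence on the path space is shift-invariant. *)
Definition stationary : Prop :=
  forall B, cylinder_sigma_algebra B ->
    P ((seq_shift \o sample_path) @^-1` B) = P (sample_path @^-1` B).

(** Shift-invariant sets of paths are trivial for the law of the sequence. *)
Definition ergodic : Prop :=
  forall B, cylinder_sigma_algebra B -> seq_shift @^-1` B = B ->
    P (sample_path @^-1` B) = 0%E \/ P (sample_path @^-1` B) = 1%E.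

End stationary_ergodic.

(** The library's expectation is a total function; it is meaningful in
    [-oo, +oo] exactly when this holds. *)
Definition expectation_well_defined (R : realType) (d : measure_display)
    (T : measurableType d) (P : probability T R) (X : T -> R) : Prop :=
  ('E_P[X^\+] < +oo)%E \/ ('E_P[X^\-] < +oo)%E.

Definition ereal_sign (R : realType) (u : \bar R) : R :=
  if (0 < u)%E then 1 else if (u < 0)%E then -1 else 0.

Section disk.
Variable R : realType.

Definition log_ratio (x : R) : R := ln ((1 + x) / (1 - x)).

(** [log_ratio] is a bijection from ]-1, 1[ onto R, so that the choice made in
    [g] below is the unique one. *)
Lemma log_ratio_ex_unique (c : R) :
  exists! x : R, -1 < x < 1 /\ c = log_ratio x.
Proof.
have E0 : 0 < expR c by exact: expR_gt0.
exists ((expR c - 1) / (expR c + 1)); split.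
  have h1 : 1 + (expR c - 1) / (expR c + 1) = 2 * expR c / (expR c + 1).
    by field; lra.
  have h2 : 1 - (expR c - 1) / (expR c + 1) = 2 / (expR c + 1).
    by field; lra.
  have p1 : 0 < 2 * expR c / (expR c + 1) by rewrite divr_gt0//; lra.
  have p2 : 0 < 2 / (expR c + 1) by rewrite divr_gt0//; lra.
  split; first by apply/andP; split; lra.
  rewrite /log_ratio h1 h2.
  have -> : 2 * expR c / (expR c + 1) / (2 / (expR c + 1)) = expR c.
    by field; lra.
  by rewrite expRK.
move=> y [/andP[y1 y2]].
have q : 0 < (1 + y) / (1 - y) by rewrite divr_gt0//; lra.
move=> ->; rewrite /log_ratio lnK ?posrE//.
have n1 : 1 - y != 0 by rewrite gt_eqF//; lra.
by field; rewrite n1 /=; have -> : 1 + y + (1 - y) = 2 by ring.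
Qed.

Definition q (alpha : R[i]) (x : R) (z : R[i]) : R[i] :=
  (z + x%:C%C * alpha) / (1 + x%:C%C * conjc alpha * z).

Definition g (alpha : R[i]) (c : R) : R[i] -> R[i] :=
  q alpha (xget 0 [set x : R | -1 < x < 1 /\ c = log_ratio x]).

Definition omega (s : nat -> R) (n : nat) : R := \sum_(i < n) log_ratio (s i).

Definition U (alpha : R[i]) (s : nat -> R) (n : nat) : R[i] -> R[i] :=
  g alpha (omega s n).

Definition busemann (xi z : R[i]) : R :=
  - ln ((1 - normc z ^+ 2) / normc (xi - z) ^+ 2).

Definition poincare_dist (z w : R[i]) : R :=
  log_ratio (normc ((z - w) / (1 - conjc z * w))).

End disk.

(* Main.v *)
(* Since g_c is the hyperbolic translation of length c along the diameter
   through alpha, B_{e alpha}(U_n z) = B_{e alpha}(z) - e omega_n for e = 1 and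
   e = -1, and d(0, U_n z) differs from |omega_n| by a bound depending only on
   z. Both limits thus reduce to omega_n / n -> E(gamma_1), the ergodic theorem
   for the shift on path space.
   The ergodic theorem is proved with Garsia's maximum
   M_(n+1) = max(0, f + M_n o tau): the set where M_n is unbounded is strictly
   invariant, and if it has full measure then dominated convergence applied to
   M_(n+1) - M_n o tau gives E f >= 0. So E f < 0 forces Birkhoff sums bounded
   above; applying this to f - c and to -f - c, after truncating from below
   when the expectation is -oo, gives the limit. *)

Require Import Defs.
From HB Require Import structures.
From mathcomp Require Import all_boot all_order all_algebra.
From mathcomp Require Import all_classical all_reals all_analysis.
From mathcomp Require Import measurable_realfun complex.
From mathcomp Require Import ring lra.

Set Implicit Arguments.
Unset Strict Implicit.
Unset Printing Implicit Defensive.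
Import Order.TTheory GRing.Theory Num.Theory.
Import numFieldNormedType.Exports.
Import ComplexField.Normc.

Local Open Scope classical_set_scope.
Local Open Scope ring_scope.

(** * Convergence of averages from linear bounds *)

Section averages.
Context (R : realType).
Implicit Types (u : nat -> R) (L : \bar R).

(** A rational slope strictly between [L] and [a] leaves a gap linear in [n], which eventually
    absorbs [C]. Restricting to rational slopes means that only countably many null sets have to be
    discarded later. *)
Lemma near_average_le u L (a : R) :
  (forall q : rat, (L < (ratr q)%:E)%E ->
    exists C : R, forall n, u n <= n%:R * ratr q + C) ->
  (L < a%:E)%E -> \forall n \near \oo, n%:R^-1 * u n <= a.
Proof.
move=> ub La.
have [q Lq qa] : exists2 q : rat, (L < (ratr q)%:E)%E & ratr q < a.
  have [b Lb ba] : exists2 b : R, (L <= b%:E)%E & b < a.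
    case: L La {ub} => [l la|//|_]; first by exists l.
    by exists (a - 1); rewrite ?leNye// ltrBlDr ltrDl.
  have [q /itvP bqa] := rat_in_itvoo ba.
  by exists q; rewrite ?bqa// (le_lt_trans Lb)// lte_fin bqa.
have [C uC] := ub q Lq; near=> n.
have n0 : 0 < n%:R :> R by rewrite ltr0n; near: n; exists 1%N.
rewrite ler_pdivrMl// (le_trans (uC n))// -lerBrDl -mulrBr.
rewrite -ler_pdivrMr ?subr_gt0//; near: n; exact: nbhs_infty_ger.
Unshelve. all: by end_near. Qed.

Lemma cvg_average u L :
  (forall q : rat, (L < (ratr q)%:E)%E ->
    exists C : R, forall n, u n <= n%:R * ratr q + C) ->
  (forall q : rat, (- L < (ratr q)%:E)%E ->
    exists C : R, forall n, - u n <= n%:R * ratr q + C) ->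
  (n%:R^-1 * u n)%:E @[n --> \oo] --> L.
Proof.
move=> ub lb.
have lo (a : R) : (a%:E < L)%E -> \forall n \near \oo, a <= n%:R^-1 * u n.
  move=> aL; have := @near_average_le (- u) _ (- a) lb.
  rewrite EFinN lteN2 => /(_ aL); apply: filterS => n /=.
  by rewrite mulrN lerN2.
have up := near_average_le ub.
case: L => [l| |] in lo up {ub lb} *.
- apply/cvg_EFin; first exact: nearW.
  apply/cvgrPdist_le => e e0.
  have {}lo := lo (l - e); have {}up := up (l + e).
  near=> n; rewrite distrC ler_distl; apply/andP; split.
    by near: n; apply: lo; rewrite lte_fin ltrBlDr ltrDl.
  by near: n; apply: up; rewrite lte_fin ltrDl.
- by apply/cvgeyPge => A; apply: lo; rewrite ltry.
- by apply/cvgeNyPle => A; apply: up; rewrite ltNyr.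
Unshelve. all: by end_near. Qed.

(** The difference [v - u] meets the linear bounds of [cvg_average] at limit 0, for every positive
    slope and with the constant [K]. *)
Lemma cvg_average_bounded_dist u v L (K : R) :
  (n%:R^-1 * u n)%:E @[n --> \oo] --> L -> (forall n, `|v n - u n| <= K) ->
  (n%:R^-1 * v n)%:E @[n --> \oo] --> L.
Proof.
move=> uL uv.
have d0 : (n%:R^-1 * (v n - u n))%:E @[n --> \oo] --> 0%E.
  apply: cvg_average => q; rewrite ?oppe0 lte_fin => q0; exists K => n.
    rewrite (le_trans (ler_norm _))// (le_trans (uv n))// lerDr mulr_ge0//.
    exact: ltW.
  rewrite (le_trans (ler_norm _))// normrN (le_trans (uv n))// lerDr mulr_ge0//.
  exact: ltW.
rewrite -(adde0 L); under eq_fun => n.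
  have -> : n%:R^-1 * v n = n%:R^-1 * u n + n%:R^-1 * (v n - u n) by ring.
  rewrite EFinD; over.
by apply: cvgeD => //; case: (L).
Qed.

End averages.

(** * Birkhoff's theorem for an ergodic transformation *)

Section birkhoff.
Context (R : realType) (d : measure_display) (X : measurableType d).
Variables (mu : probability X R) (tau : X -> X).
Hypothesis mtau : measurable_fun [set: X] tau.
Hypothesis mu_tau : forall B, measurable B -> mu (tau @^-1` B) = mu B.
Hypothesis ergodic_tau :
  forall B, measurable B -> tau @^-1` B = B -> mu B = 0%E \/ mu B = 1%E.

Definition birkhoff_sum (f : X -> R) (n : nat) (w : X) : R :=
  \sum_(i < n) f (iter i tau w).

Lemma birkhoff_sumS f n w :
  birkhoff_sum f n.+1 w = f w + birkhoff_sum f n (tau w).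
Proof.
rewrite /birkhoff_sum big_ord_recl; congr (_ + _).
by apply: eq_bigr => i _; rewrite -iterSr.
Qed.

(** This is the maximum of the Birkhoff sums of lengths 0 to [n]; the recursive form makes Garsia's
    identity hold by computation. *)
Fixpoint max_birkhoff_sum (f : X -> R) (n : nat) (w : X) : R :=
  if n is m.+1 then Num.max 0 (f w + max_birkhoff_sum f m (tau w)) else 0.

Lemma max_birkhoff_sum_ge0 f n w : 0 <= max_birkhoff_sum f n w.
Proof. by case: n => //= n; rewrite le_max lexx. Qed.

Lemma birkhoff_sum_le_max f n w : birkhoff_sum f n w <= max_birkhoff_sum f n w.
Proof.
elim: n w => [|n IH] w; first by rewrite /birkhoff_sum big_ord0.
by rewrite birkhoff_sumS /= le_max lerD2l IH orbT.
Qed.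

Lemma max_birkhoff_sum_leS f n w :
  max_birkhoff_sum f n w <= max_birkhoff_sum f n.+1 w.
Proof.
elim: n w => [|n IH] w; first exact: max_birkhoff_sum_ge0.
by rewrite /= ge_max !le_max lexx /= lerD2l IH orbT.
Qed.

Lemma max_birkhoff_sum_homo f w : nondecreasing_seq (max_birkhoff_sum f ^~ w).
Proof. by apply/nondecreasing_seqP => n; exact: max_birkhoff_sum_leS. Qed.

Lemma measurable_max_birkhoff_sum f n :
  measurable_fun setT f -> measurable_fun setT (max_birkhoff_sum f n).
Proof.
move=> mf; elim: n => [|n IH] /=; first exact: measurable_cst.
apply: measurable_maxr; first exact: measurable_cst.
by apply: measurable_funD => //; exact: measurableT_comp IH mtau.
Qed.

Lemma ge0_integral_preserving (h : X -> \bar R) :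
  measurable_fun setT h -> (forall w, 0 <= h w)%E ->
  (\int[mu]_w h (tau w) = \int[mu]_w h w)%E.
Proof.
move=> mh h0.
transitivity (\int[pushforward mu tau]_w h w)%E.
  by rewrite (ge0_integral_pushforward mtau).
by apply: eq_measure_integral => A mA _; exact: mu_tau.
Qed.

Lemma integrable_preserving (h : X -> \bar R) :
  mu.-integrable setT h -> mu.-integrable setT (h \o tau).
Proof.
case/integrableP => mh hoo; apply/integrableP; split.
  exact: measurableT_comp mh mtau.
rewrite (@ge0_integral_preserving (fun w => `|h w|%E))//.
exact: measurableT_comp.
Qed.

Lemma integrable_max_birkhoff_sum f n : mu.-integrable setT (EFin \o f) ->
  mu.-integrable setT (EFin \o max_birkhoff_sum f n).
Proof.
move=> intf; have mf : measurable_fun setT f.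
  by apply/measurable_EFinP; exact: measurable_int intf.
elim: n => [|n IH].
  by apply: (eq_integrable _ (cst 0%E)) => //; exact: integrable0.
apply: (le_integrable measurableT _ _
  (integrableD measurableT intf (integrable_preserving IH))).
  exact/measurable_EFinP/(measurable_max_birkhoff_sum n.+1).
move=> w _ /=; rewrite lee_fin.
rewrite ger0_norm ?le_max ?lexx// ge_max normr_ge0 /=; exact: ler_norm.
Qed.

Definition unbounded_birkhoff (f : X -> R) : set X :=
  [set w | forall k : nat, exists n : nat, k%:R < max_birkhoff_sum f n w].

(** M_(n+1) at [w] and M_n at [tau w] differ by at most [|f w|], so they are unbounded together.
    Raising the level [k] by more than [|f w|] pays for the difference. *)
Lemma unbounded_birkhoff_invariant f :
  tau @^-1` unbounded_birkhoff f = unbounded_birkhoff f.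
Proof.
apply/seteqP; split => w /= Aw k.
  have [n Mn] := Aw (k + Num.truncn `|f w|).+1.
  exists n.+1; rewrite /= lt_max; apply/orP; right.
  have := truncnS_gt `|f w|; have := ler_norm (- f w).
  move: Mn; rewrite normrN -addnS natrD; lra.
have [[|n] /=] := Aw (k + Num.truncn `|f w|).+1.
  by rewrite ltNge ler0n.
rewrite lt_max ltNge ler0n /= => Mn.
exists n; have := truncnS_gt `|f w|; have := ler_norm (f w).
move: Mn; rewrite -addnS natrD; lra.
Qed.

Lemma measurable_unbounded_birkhoff f :
  measurable_fun setT f -> measurable (unbounded_birkhoff f).
Proof.
move=> mf.
have -> : unbounded_birkhoff f = \bigcap_k \bigcup_n
    (max_birkhoff_sum f n @^-1` `]k%:R, +oo[).
  apply/seteqP; split => w /= Aw k.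
    by move=> _; have [n Mn] := Aw k; exists n => //=; rewrite in_itv /= Mn.
  by have [n _ /=] := Aw k I; rewrite in_itv /= andbT; exists n.
apply: bigcap_measurable => // k _; apply: bigcup_measurable => n _.
rewrite -[X in measurable X]setTI; apply: measurable_max_birkhoff_sum => //.
Qed.

(* With M_n = [max_birkhoff_sum f n], the difference M_(n+1) - M_n \o tau has a
   nonnegative integral, is dominated by |f|, and equals f once M_n \o tau is
   large. *)
Lemma integral_ge0_of_unbounded f : mu.-integrable setT (EFin \o f) ->
  mu (unbounded_birkhoff f) = 1%E -> (0 <= \int[mu]_w (f w)%:E)%E.
Proof.
move=> intf muA; set A := unbounded_birkhoff f in muA.
have mf : measurable_fun setT f.
  by apply/measurable_EFinP; exact: measurable_int intf.
have mA : measurable A := measurable_unbounded_birkhoff mf.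
pose D n w := max_birkhoff_sum f n.+1 w - max_birkhoff_sum f n (tau w).
have intM n : mu.-integrable setT (EFin \o max_birkhoff_sum f n).
  exact: integrable_max_birkhoff_sum.
have MT0 n w : 0 <= max_birkhoff_sum f n (tau w) by exact: max_birkhoff_sum_ge0.
have intMt n : mu.-integrable setT (EFin \o (max_birkhoff_sum f n \o tau)).
  exact: integrable_preserving (intM n).
have mD n : measurable_fun setT (D n).
  apply: measurable_funB; first exact: measurable_max_birkhoff_sum.
  by apply: measurableT_comp mtau; exact: measurable_max_birkhoff_sum.
(* By invariance of [mu], M_n \o tau has the integral of M_n, and M_n <= M_(n+1). *)
have intD_ge0 n : (0 <= \int[mu]_w (D n w)%:E)%E.
  under eq_integral do rewrite EFinB.
  rewrite (integralB measurableT (intM n.+1) (intMt n)) sube_ge0; last first.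
    by apply/orP; left; exact: integrable_fin_num (intMt n).
  rewrite (@ge0_integral_preserving (EFin \o max_birkhoff_sum f n)).
  - apply: le_integral => // w _; rewrite lee_fin; exact: max_birkhoff_sum_leS.
  - exact/measurable_EFinP/measurable_max_birkhoff_sum.
  - by move=> w; rewrite lee_fin max_birkhoff_sum_ge0.
have muAC : mu (~` A) = 0%E.
  by rewrite probability_setC// muA subee.
have intA (h : X -> R) : mu.-integrable setT (EFin \o h) ->
    (\int[mu]_w (h w)%:E = \int[mu]_(w in A) (h w)%:E)%E.
  move=> inth; rewrite -[X in (_ = \int[mu]_(w in X) _)%E]setTI.
  rewrite -[X in _ `&` X]setCK -setDE.
  by apply: negligible_integral => //; exact: measurableC.
rewrite intA//.
have cvgD : (\int[mu]_(w in A) (D n w)%:E)%E @[n --> \oo] -->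
            (\int[mu]_(w in A) (f w)%:E)%E.
  apply: (@dominated_cvg _ _ _ mu A mA _ _ (fun w => `|f w|%:E)).
  - move=> n; apply: measurable_funTS; exact/measurable_EFinP.
  (* Invariance moves unboundedness to [tau w]; once M_n there exceeds [|f w|], the maximum with 0
     is inactive and [D n w] is exactly [f w]. *)
  - move=> w; rewrite -[A]unbounded_birkhoff_invariant /= => Aw.
    apply: cvg_near_cst.
    have [m Mm] := Aw (Num.truncn `|f w|).+1.
    near=> n; rewrite /D /=.
    have mn : max_birkhoff_sum f m (tau w) <= max_birkhoff_sum f n (tau w).
      by apply: max_birkhoff_sum_homo; near: n; exact: nbhs_infty_ge.
    rewrite max_r; first by rewrite addrK.
    have := truncnS_gt `|f w|; have := ler_norm (- f w); rewrite normrN.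
    lra.
  - by [].
  - have /integrable_abse := intf; apply: integrableS => //.
  - move=> n w _; rewrite abse_EFin lee_fin /D /=.
    have M0 := MT0 n w.
    (* If the maximum is 0, then [D n w] is minus M_n at [tau w], a number between 0 and [- f w]. *)
    have [_|H] := leP 0 (f w + max_birkhoff_sum f n (tau w)).
      by rewrite addrK.
    by rewrite sub0r normrN ger0_norm//;
      have := ler_norm (- f w); rewrite normrN; lra.
apply: (cvge_ge _ cvgD); apply: nearW => n.
rewrite -intA//; have := integrableB measurableT (intM n.+1) (intMt n).
exact: eq_integrable.
Unshelve. all: by end_near.
Qed.

Lemma ae_birkhoff_sum_bounded f : mu.-integrable setT (EFin \o f) ->
  (\int[mu]_w (f w)%:E < 0)%E ->
  {ae mu, forall w, exists C : R, forall n, birkhoff_sum f n w <= C}.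
Proof.
move=> intf f_lt0.
have mf : measurable_fun setT f.
  by apply/measurable_EFinP; exact: measurable_int intf.
have mA := measurable_unbounded_birkhoff mf.
have [A0|A1] := ergodic_tau mA (unbounded_birkhoff_invariant f); last first.
  by have := integral_ge0_of_unbounded intf A1; rewrite leNgt f_lt0.
exists (unbounded_birkhoff f); split => // w /= nbd k.
apply: contrapT => /forallNP Mk; apply: nbd; exists k%:R => n.
by rewrite (le_trans (birkhoff_sum_le_max _ _ _))// leNgt; exact/negP.
Qed.


Lemma integral_real (f : X -> R) : (\int[mu]_w (f w)%:E =
  \int[mu]_w (f^\+%R w)%:E - \int[mu]_w (f^\-%R w)%:E)%E.
Proof. by rewrite integralE funerpos funerneg. Qed.

Lemma birkhoff_sumB_cst f (c : R) n w :
  birkhoff_sum (fun v => f v - c) n w = birkhoff_sum f n w - n%:R * c.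
Proof.
by rewrite /birkhoff_sum sumrB sumr_const card_ord mulr_natl.
Qed.

Lemma birkhoff_sumN f n w : birkhoff_sum (\- f) n w = - birkhoff_sum f n w.
Proof. by rewrite /birkhoff_sum sumrN. Qed.

Lemma birkhoff_sum_le f h n w : (forall v, f v <= h v) ->
  birkhoff_sum f n w <= birkhoff_sum h n w.
Proof. by move=> fh; exact: ler_sum. Qed.

(** Cutting the negative part off at height [k] gives an integrable majorant. By monotone
    convergence its integral tends to that of [f], even when this is -oo, so it falls below [c] for
    some [k]. *)
Lemma integrable_majorant (f : X -> R) (c : R) : measurable_fun setT f ->
  (\int[mu]_w (f^\+%R w)%:E < +oo)%E -> (\int[mu]_w (f w)%:E < c%:E)%E ->
  exists h : X -> R, [/\ mu.-integrable setT (EFin \o h),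
    (\int[mu]_w (h w)%:E < c%:E)%E & forall w, f w <= h w].
Proof.
move=> mf fp fc.
pose m (k : nat) w := Num.min (f^\-%R w) k%:R.
have mp : measurable_fun setT f^\+%R by exact: measurable_funrpos.
have mn : measurable_fun setT f^\-%R by exact: measurable_funrneg.
have mm k : measurable_fun setT (m k) by exact: measurable_minr.
have m0 k w : 0 <= m k w by rewrite le_min ler0n funrneg_ge0.
have intp : mu.-integrable setT (EFin \o f^\+%R).
  apply/integrableP; split; first exact/measurable_EFinP.
  by under eq_integral do rewrite /= ger0_norm ?funrpos_ge0//.
have intm k : mu.-integrable setT (EFin \o m k).
  apply: (le_integrable measurableT _ _
    (finite_measure_integrable_cst mu k%:R measurableT)).
  - exact/measurable_EFinP.
  - by move=> w _ /=; rewrite lee_fin !ger0_norm// ge_min lexx orbT.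
have cvgm : (\int[mu]_w (m k w)%:E)%E @[k --> \oo] -->
            (\int[mu]_w (f^\-%R w)%:E)%E.
  have -> : (\int[mu]_w (f^\-%R w)%:E =
             \int[mu]_w limn (fun k => (m k w)%:E))%E.
    apply: eq_integral => w _; apply/esym/cvg_lim => //.
    apply: cvg_near_cst; near=> k; congr EFin; apply: min_l.
    by near: k; exact: nbhs_infty_ger.
  apply: cvg_monotone_convergence => //.
  - by move=> k; exact/measurable_EFinP.
  - by move=> k w _; rewrite lee_fin.
  - move=> w _ k l kl; rewrite lee_fin le_min !ge_min lexx /=.
    by rewrite ler_nat kl orbT.
have intp_fin : (\int[mu]_w (f^\+%R w)%:E)%E \is a fin_num.
  exact: integrable_fin_num intp.
have cvgh : (\int[mu]_w (f^\+%R w)%:E - \int[mu]_w (m k w)%:E)%E @[k --> \oo]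
    --> (\int[mu]_w (f w)%:E)%E.
  (* The finite integral of the positive part rules out the form oo - oo. *)
  rewrite integral_real; apply: cvgeB => //; last exact: cvg_cst.
  by rewrite fin_num_adde_defr.
have [k hk] : exists k,
    (\int[mu]_w (f^\+%R w)%:E - \int[mu]_w (m k w)%:E < c%:E)%E.
  apply: contrapT => /forallNP hc; move: fc; rewrite ltNge => /negP; apply.
  by apply: (cvge_ge _ cvgh); apply: nearW => k; rewrite leNgt; exact/negP.
exists (fun w => f^\+%R w - m k w); split.
- by have := integrableB measurableT intp (intm k); exact: eq_integrable.
- under eq_integral do rewrite EFinB.
  by rewrite (integralB measurableT intp (intm k)).
- by move=> w; rewrite -[X in X w <= _]funrposBneg /= lerB// ge_min lexx.
Unshelve. all: by end_near. Qed.

(** With [h] an integrable majorant, [h - c] has negative integral, hence almost surely Birkhoff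
    sums bounded above. *)
Lemma ae_birkhoff_sum_le (f : X -> R) (c : R) : measurable_fun setT f ->
  (\int[mu]_w (f^\+%R w)%:E < +oo)%E -> (\int[mu]_w (f w)%:E < c%:E)%E ->
  {ae mu, forall w, exists C : R, forall n, birkhoff_sum f n w <= n%:R * c + C}.
Proof.
move=> mf fp /(integrable_majorant mf fp)[h [inth hc fh]].
have intc := finite_measure_integrable_cst mu c measurableT.
have inthc : mu.-integrable setT (EFin \o (fun v => h v - c)).
  by have := integrableB measurableT inth intc; apply: eq_integrable.
have hc0 : (\int[mu]_w (h w - c)%:E < 0)%E.
  under eq_integral do rewrite EFinB.
  rewrite integralB// integral_cst//.
  by rewrite [X in (c%:E * X)%E](probability_setT mu) mule1 suber_lt0.
apply: filterS (ae_birkhoff_sum_bounded inthc hc0) => w [C hC].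
exists C => n; rewrite (le_trans (birkhoff_sum_le _ _ fh))//.
by have := hC n; rewrite birkhoff_sumB_cst lerBlDl.
Qed.

Lemma ae_birkhoff_sum_le_rat (f : X -> R) : measurable_fun setT f ->
  (\int[mu]_w (f^\+%R w)%:E < +oo)%E \/ (\int[mu]_w (f^\-%R w)%:E < +oo)%E ->
  {ae mu, forall w (q : rat), (\int[mu]_w (f w)%:E < (ratr q)%:E)%E ->
    exists C : R, forall n, birkhoff_sum f n w <= n%:R * ratr q + C}.
Proof.
move=> mf wd.
(* Rationals are enumerated by their codes, so that a countable union of null sets gives one null
   set for all slopes. *)
suff : {ae mu, forall w k q, unpickle k = Some q ->
    (\int[mu]_w (f w)%:E < (ratr q)%:E)%E ->
    exists C : R, forall n, birkhoff_sum f n w <= n%:R * ratr q + C}.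
  by apply: filterS => w H q; exact: (H (pickle q)) (pickleK q).
apply: ae_foralln => k; case: (unpickle k) => [q|]; last exact: nearW.
have [fq|nfq] := pselect (\int[mu]_w (f w)%:E < (ratr q)%:E)%E; last first.
  by apply: nearW => w p [<-].
(* If only the negative part were known to be integrable and the positive part were not, the
   integral would be +oo, above every rational. *)
have fp : (\int[mu]_w (f^\+%R w)%:E < +oo)%E.
  case: wd => // fn; rewrite ltey; apply/eqP => fpy; move: fq.
  by rewrite integral_real fpy addye//; move: fn; case: integral.
by apply: filterS (ae_birkhoff_sum_le mf fp fq) => w H p [<-].
Qed.

Theorem birkhoff_ergodic (f : X -> R) : measurable_fun setT f ->
  (\int[mu]_w (f^\+%R w)%:E < +oo)%E \/ (\int[mu]_w (f^\-%R w)%:E < +oo)%E ->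
  {ae mu, forall w, (n%:R^-1 * birkhoff_sum f n w)%:E @[n --> \oo] -->
    (\int[mu]_w (f w)%:E)%E}.
Proof.
move=> mf wd.
(* Lower bounds come from [\- f]. Negation passes through the integral because [wd] excludes oo -
   oo. *)
have intN : (- (\int[mu]_w (f w)%:E) =
      \int[mu]_w ((\- f) w)%:E)%E.
  rewrite (integral_real f) (integral_real (\- f)) funrposN funrnegN.
  rewrite oppeB; first by rewrite addeC.
  have p0 : (0 <= \int[mu]_w (f^\+%R w)%:E)%E.
    by apply: integral_ge0 => w _; rewrite lee_fin funrpos_ge0.
  have n0 : (0 <= \int[mu]_w (f^\-%R w)%:E)%E.
    by apply: integral_ge0 => w _; rewrite lee_fin funrneg_ge0.
  by case: wd p0 n0; case: integral; case: integral.
have up := ae_birkhoff_sum_le_rat mf wd.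
have /ae_birkhoff_sum_le_rat lo : measurable_fun setT (\- f).
  exact: measurableT_comp.
apply: filterS2 up (lo _) => [w fw nfw|].
  apply: cvg_average => // q; rewrite intN => /nfw[C hC].
  by exists C => n; rewrite -birkhoff_sumN.
by rewrite funrposN funrnegN or_comm.
Qed.

End birkhoff.

(** * Hyperbolic translations of the disk *)

Section disk_automorphism.
Context (R : realType).
Implicit Types (a z w xi : R[i]) (c t e : R).

Lemma normc_ge0 z : 0 <= normc z.
Proof. by case: z => u v; rewrite sqrtr_ge0. Qed.

Lemma normc_conjc z : normc (conjc z) = normc z.
Proof. by case: z => u v; rewrite /normc /= sqrrN. Qed.

Lemma normc_real t : normc t%:C%C = `|t|.
Proof. by rewrite /normc /= expr0n addr0 sqrtr_sqr. Qed.

Lemma mulcJ a : a * conjc a = (normc a ^+ 2)%:C%C.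
Proof.
case: a => u v; rewrite /normc sqr_sqrtr ?addr_ge0 ?sqr_ge0//.
by apply/eqP; rewrite eq_complex /=; apply/andP; split; apply/eqP; ring.
Qed.

(** The set inside [xget] is inhabited, so its default value 0 is never a fallback. *)
Lemma gE a c : exists t, [/\ -1 < t < 1, c = log_ratio t & g a c = q a t].
Proof.
have [t [[t1 ct] _]] := log_ratio_ex_unique c.
rewrite /g; case: xgetP => [y _ [y1 cy]|/(_ t)[]//].
by exists y.
Qed.

Lemma log_ratioN t : -1 < t < 1 -> log_ratio (- t) = - log_ratio t.
Proof.
move=> /andP[t1 t2]; rewrite /log_ratio opprK -lnV ?invf_div//.
by rewrite posrE divr_gt0//; lra.
Qed.

Lemma ln_bounds (m M y : R) : 0 < m -> m <= y <= M ->
  `|ln y| <= `|ln m| + `|ln M|.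
Proof.
move=> m0 /andP[my yM].
have y0 : 0 < y by exact: lt_le_trans my.
have M0 : 0 < M by exact: lt_le_trans yM.
have : ln m <= ln y by rewrite ler_ln.
have : ln y <= ln M by rewrite ler_ln.
have := ler_norm (ln M); have := ler_norm (- ln m); rewrite normrN.
have := normr_ge0 (ln M); have := normr_ge0 (ln m).
by move=> *; rewrite ler_norml; apply/andP; split; lra.
Qed.

Section fixed_automorphism.
Variables (a z : R[i]) (t : R).
Hypotheses (a1 : normc a = 1) (z1 : normc z < 1).
Hypotheses (t_gtN1 : -1 < t) (t_lt1 : t < 1).

Definition q_den : R[i] := 1 + t%:C%C * conjc a * z.

(** Both triangle inequalities apply, the second to 1 as [q_den] minus its last term. The bounds are
    free of [t], hence uniform in [n] when used for U_n. *)
Lemma normc_q_den : 1 - normc z <= normc q_den <= 2.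
Proof.
have tlb := t_gtN1; have tub := t_lt1.
have tz : normc (t%:C%C * conjc a * z) <= normc z.
  rewrite !normcM normc_real normc_conjc a1 mulr1 ler_piMl ?normc_ge0//.
  by rewrite ler_norml !ltW//; lra.
have ub : normc q_den <= 1 + normc (t%:C%C * conjc a * z).
  by rewrite -(@normc1 R); exact: le_normcD.
have lb : 1 <= normc q_den + normc (t%:C%C * conjc a * z).
  rewrite -(@normc1 R) -(normcN (t%:C%C * conjc a * z)).
  by rewrite -[X in normc X](addrK (t%:C%C * conjc a * z)); exact: le_normcD.
rewrite lerBlDr (le_trans lb) ?lerD2l//= (le_trans ub)//.
by rewrite -[leRHS]/(1 + 1) lerD2l (le_trans tz)// ltW.
Qed.

Lemma normc_q_den_gt0 : 0 < normc q_den.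
Proof.
by have /andP[+ _] := normc_q_den; apply: lt_le_trans; rewrite subr_gt0.
Qed.

Lemma q_den_neq0 : q_den != 0.
Proof. by apply/eqP => D0; have := normc_q_den_gt0; rewrite D0 normc0 ltxx. Qed.

(** This is the equality case of Schwarz-Pick: the factor in front of 1 - |z|^2 is the modulus of
    the derivative of [q a t] at [z]. *)
Lemma onem_normc_q :
  1 - normc (q a t z) ^+ 2 =
  (1 - t ^+ 2) * (1 - normc z ^+ 2) / normc q_den ^+ 2.
Proof.
have D0 := normc_q_den_gt0.
rewrite /q -/q_den normcM normcV expr_div_n.
have -> : 1 - normc (z + t%:C%C * a) ^+ 2 / normc q_den ^+ 2 =
    (normc q_den ^+ 2 - normc (z + t%:C%C * a) ^+ 2) / normc q_den ^+ 2.
  by field; rewrite gt_eqF.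
(* In real coordinates this is a polynomial identity modulo |a|^2 = 1, used to eliminate the square
   of the real part of [a]. *)
congr (_ / _); rewrite /q_den; move: a1 {D0}; clear.
case: a => a' a''; case: z => u v /(congr1 (fun x => x ^+ 2)).
rewrite /normc !sqr_sqrtr ?addr_ge0 ?sqr_ge0//= expr1n => a1.
have E : a' ^+ 2 = 1 - a'' ^+ 2 by rewrite -a1 addrK.
ring: E.
Qed.

(** The point e a is fixed by [q a t]. Thus, over the denominator [q_den], the numerator of e a -
    q(z) is affine in z and vanishes at e a, so it is a multiple of e a - z. *)
Lemma normc_sub_q e : e ^+ 2 = 1 ->
  normc (e%:C%C * a - q a t z) =
  (1 - e * t) * normc (e%:C%C * a - z) / normc q_den.
Proof.
have tlb := t_gtN1; have tub := t_lt1.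
move=> e1; have D0 := q_den_neq0.
have et : 0 <= 1 - e * t.
  have /orP[]: (e == 1) || (e == -1) by rewrite -sqrf_eq1 e1.
    by move/eqP ->; lra.
  by move/eqP ->; lra.
rewrite -[X in X * normc _](ger0_norm et) -normc_real -normcV -!normcM.
congr normc.
have aJ : a * conjc a = 1 by rewrite mulcJ a1 expr1n.
have e2 : e%:C%C * e%:C%C = 1 by rewrite -rmorphM /= -expr2 e1.
apply: (mulIf D0); rewrite mulfVK// mulrBl /q -/q_den mulfVK//.
rewrite /q_den rmorphB rmorphM rmorph1 /=.
transitivity (e%:C%C * a + e%:C%C * t%:C%C * (a * conjc a) * z -
    (z + t%:C%C * a)).
  by ring.
rewrite aJ.
transitivity (e%:C%C * a - (e%:C%C * e%:C%C) * t%:C%C * a - z +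
    e%:C%C * t%:C%C * z); last by ring.
by rewrite e2; ring.
Qed.

Lemma onem_sqr_gt0 : 0 < 1 - t ^+ 2.
Proof.
by rewrite subr_gt0 -(real_normK (num_real t)) expr_lt1// ltr_norml t_gtN1.
Qed.

Lemma onem_normc_sqr_gt0 : 0 < 1 - normc z ^+ 2.
Proof. by rewrite subr_gt0 expr_lt1// normc_ge0. Qed.

(** In the quotient defining the Busemann function [q_den] cancels, and (1 - t^2) / (1 - e t)^2 = (1
    + e t) / (1 - e t) remains as the new factor. *)
Lemma busemann_q e : e ^+ 2 = 1 ->
  busemann (e%:C%C * a) (q a t z) = busemann (e%:C%C * a) z - e * log_ratio t.
Proof.
have tlb := t_gtN1; have tub := t_lt1.
move=> e1; rewrite /busemann onem_normc_q normc_sub_q//.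
have N0 : 0 < normc (e%:C%C * a - z).
  rewrite lt_def normc_ge0 andbT; apply/eqP => /eq0_normc /eqP.
  rewrite subr_eq0 => /eqP ez; move: z1; rewrite -ez normcM a1 normc_real mulr1.
  have /orP[]: (e == 1) || (e == -1) by rewrite -sqrf_eq1 e1.
    by move/eqP ->; rewrite normr1 ltxx.
  by move/eqP ->; rewrite normrN normr1 ltxx.
have elog : e * log_ratio t = ln ((1 + e * t) / (1 - e * t)).
  have /orP[]: (e == 1) || (e == -1) by rewrite -sqrf_eq1 e1.
    by move/eqP ->; rewrite !mul1r.
  by move/eqP ->; rewrite !mulN1r -log_ratioN// t_gtN1.
have [et1 et2] : -1 < e * t /\ e * t < 1.
  have /orP[]: (e == 1) || (e == -1) by rewrite -sqrf_eq1 e1.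
    by move/eqP ->; rewrite mul1r.
  by move/eqP ->; rewrite mulN1r; split; lra.
have z0 := onem_normc_sqr_gt0; have D0 := normc_q_den_gt0.
rewrite elog -opprD; congr (- _); rewrite -lnM; last 2 first.
- by rewrite posrE divr_gt0// exprn_gt0.
- by rewrite posrE divr_gt0//; lra.
congr ln; rewrite (_ : 1 - t ^+ 2 = (1 - e * t) * (1 + e * t)); last first.
  by ring: e1.
by field; rewrite !gt_eqF//=; lra.
Qed.

(** Writing (1 + r) / (1 - r) as (1 + r)^2 / (1 - r^2), for r = |q(z)| and for |t|, makes the
    degenerating factor 1 - t^2 cancel in the difference of logarithms. *)
Lemma poincare_dist_q : `|poincare_dist 0 (q a t z) - `|log_ratio t| | <=
  `|ln ((1 - normc z) ^+ 2 / 4)| + `|ln (16 / (1 - normc z ^+ 2))|.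
Proof.
have tlb := t_gtN1; have tub := t_lt1; have zub := z1.
have z0 := onem_normc_sqr_gt0; have D0 := normc_q_den_gt0.
have t0 := onem_sqr_gt0.
have /andP[Dlb Dub] := normc_q_den.
have s0 := normc_ge0 z.
rewrite /poincare_dist sub0r rmorph0 mul0r subr0 divr1 normcN.
have qE := onem_normc_q.
have r0 := normc_ge0 (q a t z).
set r := normc (q a t z) in qE r0 *.
have r1 : 0 < 1 - r ^+ 2 by rewrite qE divr_gt0 ?mulr_gt0 ?exprn_gt0.
have r2 : r < 1 by rewrite -(@expr_lt1 _ 2)// -subr_gt0.
have log_ge0 u : 0 <= u -> u < 1 -> 0 <= log_ratio u.
  by move=> u0 u1; rewrite ln_ge0// ler_pdivlMr; lra.
have -> : `|log_ratio t| = log_ratio `|t|.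
  have [t2|t2] := leP 0 t; first by rewrite (ger0_norm t2) ger0_norm// log_ge0.
  rewrite (ltr0_norm t2) -normrN -log_ratioN ?t_gtN1//.
  by rewrite ger0_norm// log_ge0//; lra.
have tt : `|t| < 1 by rewrite ltr_norml t_gtN1.
have tt0 := normr_ge0 t.
have -> : log_ratio r - log_ratio `|t| =
    ln ((1 + r) ^+ 2 * normc q_den ^+ 2 /
        ((1 + `|t|) ^+ 2 * (1 - normc z ^+ 2))).
  rewrite /log_ratio -ln_div ?posrE ?divr_gt0//; try lra.
  congr ln.
  have -> : (1 + r) / (1 - r) = (1 + r) ^+ 2 / (1 - r ^+ 2).
    by field; rewrite !gt_eqF//; lra.
  rewrite qE -(real_normK (num_real t)).
  have tt2 : 0 < 1 - `|t| ^+ 2 by rewrite real_normK ?num_real.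
  by field; rewrite !gt_eqF//=; lra.
apply: ln_bounds; first by rewrite divr_gt0// exprn_gt0// subr_gt0.
(* The numerator lies between (1 - |z|)^2 and 4 * 4, the denominator between 1 - |z|^2 and 4; this
   gives the two constants of the statement. *)
have b1 : 1 <= (1 + r) ^+ 2 <= 4 by apply/andP; split; nra.
have b2 : (1 - normc z) ^+ 2 <= normc q_den ^+ 2 <= 4 by apply/andP; split; nra.
have b3 : 1 <= (1 + `|t|) ^+ 2 <= 4 by apply/andP; split; nra.
move: b1 b2 b3; set x1 := (1 + r) ^+ 2; set x2 := normc q_den ^+ 2.
set x3 := (1 + `|t|) ^+ 2 => /andP[? ?] /andP[? ?] /andP[? ?].
have z2 : 1 - normc z ^+ 2 <= 1 by rewrite gerBl sqr_ge0.
have m0 : 0 <= (1 - normc z) ^+ 2 by exact: sqr_ge0.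
have x12 : (1 - normc z) ^+ 2 <= x1 * x2.
  by rewrite -[leLHS]mul1r ler_pM.
have x12' : x1 * x2 <= 16.
  by rewrite (_ : 16 = 4 * 4)//; [rewrite ler_pM//; lra|ring].
have x3z : x3 * (1 - normc z ^+ 2) <= 4.
  by rewrite -[leRHS]mulr1 ler_pM//; lra.
have x3z' : 1 - normc z ^+ 2 <= x3 * (1 - normc z ^+ 2).
  by rewrite ler_peMl//; lra.
apply/andP; split; apply: ler_pM => //;
  rewrite ?invr_ge0 ?lef_pV2 ?posrE//; lra.
Qed.

End fixed_automorphism.

End disk_automorphism.

(** * The shift on path space *)

Section path_space.
Context (R : realType).

(** These are the generators in [cylinder_sigma_algebra], so the measurable sets of [path_type] are
    by conversion those in [stationary] and [ergodic]. *)
Definition cylinders : set_system (nat -> R) :=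
  \bigcup_n preimage_set_system setT (fun s : nat -> R => s n) measurable.

Notation path_type := (g_sigma_algebraType cylinders).

Lemma measurable_coordinate n :
  measurable_fun [set: path_type] (fun s : path_type => s n).
Proof.
move=> _ B mB; rewrite setTI; apply: sub_sigma_algebra.
by exists n => //; exists B => //; rewrite setTI.
Qed.

Lemma measurable_to_path d (T : measurableType d) (f : T -> path_type) :
  (forall n, measurable_fun setT (fun w => f w n)) -> measurable_fun setT f.
Proof.
move=> mf; apply: (@measurability _ _ _ path_type _ _ cylinders) => //.
move=> _ [_ [n _ [B mB <-]] <-].
have -> : [set: T] `&` f @^-1` ([set: nat -> R] `&` (fun s => s n) @^-1` B) =
    [set: T] `&` (fun w => f w n) @^-1` B by rewrite setTI.
exact: mf.
Qed.

Lemma measurable_seq_shift :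
  measurable_fun [set: path_type] (seq_shift : path_type -> path_type).
Proof. by apply: measurable_to_path => n; exact: measurable_coordinate. Qed.

(* Outside ]-1, 1[ the quotient is nonpositive or divided by zero, where [ln]
   is 0. *)
Lemma log_ratioE (t : R) :
  log_ratio t = \1_`]-1, 1[ t * (ln (1 + t) - ln (1 - t)).
Proof.
rewrite /log_ratio indicE.
have [t1|] := boolP (t \in `]-1, 1[%classic).
  move: t1; rewrite inE /= in_itv /= => /andP[t1 t2].
  by rewrite mul1r ln_div// posrE; lra.
rewrite notin_setE /= in_itv /= => /negP; rewrite negb_and -!leNgt mul0r.
move=> /orP[t1|t1]; apply: ln0.
  by rewrite mulr_le0_ge0 ?invr_ge0//; lra.
by rewrite mulr_ge0_le0 ?invr_le0//; lra.
Qed.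

Lemma measurable_log_ratio : measurable_fun setT (@log_ratio R).
Proof.
rewrite (funext log_ratioE); apply: measurable_funM.
  exact: measurable_indic.
by apply: measurable_funB; apply: measurableT_comp (@measurable_ln R) _;
  [exact: measurable_funD|exact: measurable_funB].
Qed.

Lemma sum_seq_shift (h : R -> R) n (s : path_type) :
  birkhoff_sum (seq_shift : path_type -> path_type) (fun s => h (s 0%N)) n s =
  \sum_(i < n) h (s i).
Proof.
have iterE k (r : nat -> R) : iter k seq_shift r 0%N = r k.
  by elim: k r => // k IH r; rewrite iterSr IH.
by apply: eq_bigr => i _; rewrite iterE.
Qed.

(** No transformation is given on [T], so Birkhoff's theorem is applied to the shift under the law
    of the sequence and the null set is pulled back. *)
Lemma strong_law d (T : measurableType d) (P : probability T R)
    (x : nat -> {RV P >-> R}) (h : R -> R) :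
  stationary x -> ergodic x -> measurable_fun setT h ->
  expectation_well_defined P (h \o x 0%N) ->
  {ae P, forall w, (n%:R^-1 * \sum_(i < n) h (x i w))%:E @[n --> \oo] -->
    ('E_P[h \o x 0%N])%E}.
Proof.
move=> stat erg mh wd.
have mX : measurable_fun setT (sample_path x : T -> path_type).
  by apply: measurable_to_path => n; exact: measurable_funP.
pose X : {RV P >-> path_type} := HB.pack (sample_path x : T -> path_type)
  (isMeasurableFun.Build _ _ _ _ _ mX).
pose mu : probability path_type R := distribution P X.
pose f (s : path_type) := h (s 0%N).
have mf : measurable_fun setT f.
  exact: measurableT_comp mh (measurable_coordinate 0).
(* Change of variables is done for nonnegative functions, then on both parts of [f], so infinite
   expectations are covered. *)
have int_pos (k : path_type -> R) :
    measurable_fun setT k -> (forall s, 0 <= k s) ->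
    (\int[mu]_s (k s)%:E = \int[P]_w (k (sample_path x w))%:E)%E.
  by move=> mk k0; rewrite ge0_integral_distribution//; exact/measurable_EFinP.
have mu_shift (B : set path_type) :
    measurable B -> mu (seq_shift @^-1` B) = mu B.
  by move=> mB; exact: stat.
have mu_erg (B : set path_type) :
    measurable B -> seq_shift @^-1` B = B -> mu B = 0%E \/ mu B = 1%E.
  by move=> mB; exact: erg.
have intfp : (\int[mu]_s (f^\+%R s)%:E = 'E_P[(h \o x 0%N)^\+%R])%E.
  by rewrite int_pos ?unlock//; exact: measurable_funrpos.
have intfn : (\int[mu]_s (f^\-%R s)%:E = 'E_P[(h \o x 0%N)^\-%R])%E.
  by rewrite int_pos ?unlock//; exact: measurable_funrneg.
have intf : (\int[mu]_s (f s)%:E = 'E_P[h \o x 0%N])%E.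
  by rewrite integral_real intfp intfn unlock -integral_real.
have := @birkhoff_ergodic _ _ _ mu _ measurable_seq_shift mu_shift mu_erg f mf.
rewrite intfp intfn intf => /(_ wd)[N [mN muN0 NS]].
exists (sample_path x @^-1` N); split => //.
  by rewrite -[Y in measurable Y]setTI; exact: mX measurableT _ mN.
move=> w /= nw; apply: NS => /= cv; apply: nw.
by under eq_fun do rewrite -(sum_seq_shift h _ (sample_path x w)).
Qed.

End path_space.

(** * The two limits along U_n(z) *)

Theorem theorem2 (R : realType) (d : measure_display) (T : measurableType d)
    (P : probability T R) (alpha : R[i]) (x : nat -> {RV P >-> R}) :
  normc alpha = 1 ->
  stationary x ->
  ergodic x ->
  P [set w | -1 < x 0%N w < 1] = 1%E ->
  let gamma1 : T -> R := fun w => log_ratio (x 0%N w) in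
  expectation_well_defined P gamma1 ->
  let eps : R := ereal_sign 'E_P[gamma1] in
  eps != 0 ->
  {ae P, forall w, forall z : R[i], normc z < 1 ->
    ((n%:R^-1 * busemann (eps%:C%C * alpha) (U alpha (sample_path x w) n z))%:E
       @[n --> \oo] --> (- `|'E_P[gamma1]|)%E) /\
    ((n%:R^-1 * poincare_dist 0 (U alpha (sample_path x w) n z))%:E
       @[n --> \oo] --> `|'E_P[gamma1]|%E)}.
Proof.
move=> a1 stat erg _ gamma1 wd eps eps0.
apply: filterS (strong_law stat erg (@measurable_log_ratio R) wd) => w.
(* The sums [omega] do not involve [z], so one null set serves the whole disk. *)
rewrite -/(omega (sample_path x w) _) -/gamma1 => cvE z z1.
set L := ('E_P[gamma1])%E in eps eps0 cvE *.
set u := omega (sample_path x w).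
have eps1 : eps ^+ 2 = 1.
  move: eps0; rewrite /eps /ereal_sign; case: ifP => _; first by rewrite expr1n.
  by case: ifP => _; rewrite ?eqxx// sqrrN expr1n.
have epsL : (eps%:E * L = `|L|)%E.
  move: eps0; rewrite /eps /ereal_sign; case: ifPn => [L0 _|_].
    by rewrite mul1e gee0_abs// ltW.
  case: ifPn => [L0 _|]; last by rewrite eqxx.
  by rewrite EFinN mulN1e lte0_abs.
split.
(* By [busemann_q] the distance to [- (eps * u n)] is exactly |B(z)|, for every [n]. *)
- apply: (@cvg_average_bounded_dist _ (fun n => - (eps * u n)) _ _
    `|busemann (eps%:C%C * alpha) z|).
    under eq_fun do rewrite mulrN mulrCA EFinN EFinM.
    by apply: cvgeN; rewrite -epsL; apply: cvgeZl.
  move=> n; rewrite /U -/u; have [t [/andP[t1 t2] ut ->]] := gE alpha (u n).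
  by rewrite busemann_q// ut opprK subrK.
- apply: (@cvg_average_bounded_dist _ (fun n => `|u n|) _ _
    (`|ln ((1 - normc z) ^+ 2 / 4)| + `|ln (16 / (1 - normc z ^+ 2))|)).
    under eq_fun => n.
      rewrite (_ : _ * _ = `|n%:R^-1 * u n|); last first.
        by rewrite normrM ger0_norm// invr_ge0.
      rewrite -abse_EFin; over.
    exact: cvg_abse.
  move=> n; rewrite /U -/u; have [t [/andP[t1 t2] ut ->]] := gE alpha (u n).
  by rewrite ut; exact: poincare_dist_q.
Qed.
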